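(* For every monomial ideal $I\subset R=\mathbf{k}[x_1,\dots,x_n]$ and every Mayer-Vietoris tree $MVT(I)$ of it, there is a resolution of $I$ supported on the relevant nodes of $MVT(I)$; that is, there is a multigraded free resolution $\cdots\to \mathcal{P}_1\to \mathcal{P}_0\to 0$ of $I$ as an $R$-module with $$\mathcal{P}_i=\bigoplus_{J}\ \bigoplus_{x^\mu} R(-\mu)\qquad (i\ge 0),$$ where $J$ runs over the relevant nodes of dimension $i$ of $MVT(I)$ and $x^\mu$ runs over the minimal monomial generators of $J$.
   Context: $\mathbf{k}$ is a field of characteristic $0$, $R=\mathbf{k}[x_1,\dots,x_n]$ with its $\mathbb{N}^n$-grading; $R(-\mu)$ is the free module of rank one generated in multidegree $\mu$. Monomial ideals are nonzero. Mayer-Vietoris trees: a Mayer-Vietoris tree $MVT(I)$ of $I$ is a rooted binary tree whose nodes are (labelled by) monomial ideals, with root $I$. Whenever a node $J$ has minimal monomial generating set $\{m_1,\dots,m_s\}$ with $s\geq 2$, one minimal generator (the pivot monomial) is chosen, the choice being arbitrary at each node; numbering so that the pivot is $m_s$, the node $J$ has exactly two children: the left child $\tilde J=\langle m_1,\dots,m_{s-1}\rangle\cap\langle m_s\rangle=\langle \mathrm{lcm}(m_1,m_s),\dots,\mathrm{lcm}(m_{s-1},m_s)\rangle$ and the right child $J'=\langle m_1,\dots,m_{s-1}\rangle$. Nodes with a single minimal generator are leaves. Positions: the root has position $1$; if a node has position $p$, its left child has position $2p$ and its right child position $2p+1$. Dimensions: the root has dimension $0$; if a node has dimension $d$, its left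 child has dimension $d+1$ and its right child dimension $d$. A node is relevant if its position is $1$ or even. *)

(* Defs.v *)
From HB Require Import structures.
From mathcomp Require Import all_boot all_order all_algebra.
From mathcomp.multinomials Require Import mpoly.

Set Implicit Arguments.
Unset Strict Implicit.
Unset Printing Implicit Defensive.

Import GRing.Theory.
Local Open Scope ring_scope.

Section MonomialIdeals.
Variables (k : fieldType) (n : nat).
Local Notation R := {mpoly k[n]}.

(* Ideals are Prop-valued predicates on R; this one is the ideal generated by
   the (possibly infinite) set S of monomials. *)
Definition mon_ideal (S : 'X_{1..n} -> Prop) : R -> Prop := fun f =>
  exists2 s : seq (R * 'X_{1..n}),
    (forall q, q \in s -> S q.2) & f = \sum_(q <- s) q.1 * 'X_[q.2].

Definition mon_ideal_seq (G : seq 'X_{1..n}) : R -> Prop :=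
  mon_ideal (fun m => m \in G).

Definition nz_monomial_ideal (J : R -> Prop) : Prop :=
  (exists S, forall f, J f <-> mon_ideal S f) /\ (exists2 f, J f & f != 0).

Definition ideal_cap (J K : R -> Prop) : R -> Prop := fun f => J f /\ K f.

Definition min_mon_gens (J : R -> Prop) (G : seq 'X_{1..n}) : Prop :=
  [/\ uniq G,
      forall f, J f <-> mon_ideal_seq G f &
      forall G', {subset G' <= G} -> (forall f, J f <-> mon_ideal_seq G' f) ->
        {subset G <= G'}].

(* [mvt J] is the type of the Mayer-Vietoris trees with root J, so every node
   is labelled by the ideal indexing the type of its subtree; G lists the
   minimal generators of the node, p is the pivot monomial, and the left child
   comes before the right one. *)
Inductive mvt (J : R -> Prop) : Type :=
| MVLeaf (m : 'X_{1..n}) of min_mon_gens J [:: m]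
| MVNode (G : seq 'X_{1..n}) (p : 'X_{1..n}) of
    min_mon_gens J G & (2 <= size G)%N & p \in G &
    mvt (ideal_cap (mon_ideal_seq (rem p G)) (mon_ideal_seq [:: p])) &
    mvt (mon_ideal_seq (rem p G)).

Record mvt_node := MvtNode {
  node_pos : nat;
  node_dim : nat;
  node_gens : seq 'X_{1..n}
}.

Fixpoint mvt_nodes_from (pos dim : nat) (J : R -> Prop) (T : mvt J) :
    seq mvt_node :=
  match T with
  | MVLeaf m _ => [:: MvtNode pos dim [:: m]]
  | MVNode G _ _ _ _ Tl Tr =>
      MvtNode pos dim G ::
        mvt_nodes_from (2 * pos) dim.+1 Tl ++
        mvt_nodes_from (2 * pos).+1 dim Tr
  end.

Definition mvt_nodes (J : R -> Prop) (T : mvt J) : seq mvt_node :=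
  mvt_nodes_from 1 0 T.

Definition relevant (v : mvt_node) : bool :=
  (node_pos v == 1)%N || ~~ odd (node_pos v).

Definition mvt_degrees (J : R -> Prop) (T : mvt J) (i : nat) :
    seq 'X_{1..n} :=
  flatten [seq node_gens v | v <- mvt_nodes T & relevant v && (node_dim v == i)].

End MonomialIdeals.

Section MultigradedResolutions.
Variables (k : fieldType) (n : nat).
Local Notation R := {mpoly k[n]}.

(* The multigraded free module \bigoplus_(mu <- s) R(-mu): its underlying
   R-module is free of rank [size s], and [grfree_comp] gives its multigraded
   components. *)
Definition grfree (s : seq 'X_{1..n}) := 'rV[R]_(size s).

(* R(-mu)_gamma consists of the f whose monomials m all satisfy
   m + mu = gamma. *)
Definition grfree_comp (s : seq 'X_{1..n}) (gamma : 'X_{1..n})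
    (v : grfree s) : Prop :=
  forall (j : 'I_(size s)) (m : 'X_{1..n}),
    m \in msupp (v 0 j) -> (m + nth 0 s j)%MM = gamma.

Definition mpoly_comp (gamma : 'X_{1..n}) (f : R) : Prop :=
  forall m, m \in msupp f -> m = gamma.

(* The complex
     ... -> P_2 -d 1-> P_1 -d 0-> P_0 -eps-> I -> 0,
   with P_i = \bigoplus_(mu <- degs i) R(-mu), is exact with maps of multidegree
   0; eps is written as a map to R whose image is I. *)
Record mg_free_resolution (I : R -> Prop) (degs : nat -> seq 'X_{1..n})
    (eps : {linear 'rV[R]_(size (degs 0)) -> R^o})
    (d : forall i,
      {linear 'rV[R]_(size (degs i.+1)) -> 'rV[R]_(size (degs i))}) : Prop := {
  res_eps_graded : forall gamma (v : grfree (degs 0)),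
    grfree_comp gamma v -> mpoly_comp gamma (eps v);
  res_d_graded : forall i gamma (v : grfree (degs i.+1)),
    grfree_comp gamma v -> @grfree_comp (degs i) gamma (d i v);
  res_eps_image : forall f, I f <-> exists v, eps v = f;
  res_exact0 : forall v, eps v = 0 <-> exists w, d 0 w = v;
  res_exact : forall i v, d i v = 0 <-> exists w, d i.+1 w = v
}.

End MultigradedResolutions.

(* Main.v *)
Require Import Defs.
From HB Require Import structures.
From mathcomp Require Import all_boot all_order all_algebra.
From mathcomp.multinomials Require Import mpoly.

Import GRing.Theory.
Local Open Scope ring_scope.

(** Let J be a node with minimal generators G and pivot p, let J~ and J' be its
    left and right children, and let F(G) be the free module on G.  Write K for
    the kernel of the canonical map F(G) -> J, and K' for the kernel of
    F(G') -> J', where G' lists the minimal generators of J'.  Since J' is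
    generated by G minus p, and minimal monomial generators are unique, G' is
    G minus p up to order.  Sending u in K to u_p x^p gives an exact sequence
      0 -> K' -> K -> J~ -> 0,
    because a relation u writes u_p x^p as minus a combination of the other
    generators, so that u_p x^p runs over the intersection of J' and <p>, and
    because u_p x^p = 0 forces u_p = 0.

    The horseshoe lemma therefore resolves K by the direct sum of a resolution
    of J~ and a resolution of K'.  By induction on the tree the latter two are
    known, K' being resolved by the terms of positive degree in the resolution
    of J'; at a leaf K is 0.  Hence
      P_0(J) = F(G)  and  P_(i+1)(J) = P_i(J~) + P_(i+1)(J')
    ([gens_ker_resolves], from [horseshoe] and [pivot_ker_resolves]).  This
    recursion is also the one satisfied by the relevant nodes: a left child is
    relevant and one dimension up, whereas a right child is irrelevant and of
    the same dimension as its parent, so that its own generators, which already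
    occur among those of the parent, are not counted again ([mvt_degreesE]).

    Applying the horseshoe lemma to the kernels K, instead of a mapping cone to
    the ideals, means that no chain map between resolutions has to be
    constructed: each step lifts the generators of one free module.

    Multigraded maps between free modules are matrices with homogeneous
    entries, acting on row vectors from the right; an ideal is viewed as a
    submodule of the free module on one generator of degree 0. *)

(** * Multigraded matrices and homogeneous components *)

Section GradedMaps.
Context {k : fieldType} {n : nat}.
Local Notation R := {mpoly k[n]}.
Local Notation mon := 'X_{1..n}.
Implicit Types (r s t : seq mon) (g : mon).

(** A matrix of multidegree 0 from the free module on basis degrees t to the one
    on s.  A row vector is homogeneous of multidegree g exactly when it is
    graded with t = [:: g]. *)
Definition graded_mx t s (D : 'M[R]_(size t, size s)) : Prop :=
  forall i j (m : mon), m \in msupp (D i j) ->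
    (m + nth 0 s j)%MM = nth 0%MM t i.

Lemma graded_mulmx {r t s} {A : 'M[R]_(size r, size t)}
    {B : 'M[R]_(size t, size s)} :
  graded_mx r t A -> graded_mx t s B -> graded_mx r s (A *m B).
Proof.
move=> hA hB i j m; rewrite mxE => /msupp_sum_le /flattenP [_ /mapP [l _ ->]].
move=> /msuppM_le /allpairsP [[a b] /= [/hA ha /hB hb ->]].
by rewrite -ha -hb addmA.
Qed.

Lemma graded_addmx {t s} {A B : 'M[R]_(size t, size s)} :
  graded_mx t s A -> graded_mx t s B -> graded_mx t s (A + B).
Proof.
move=> hA hB i j m; rewrite mxE => /msuppD_le; rewrite mem_cat.
by case/orP => [/hA|/hB].
Qed.

Lemma graded_rowP {t s} {D : 'M[R]_(size t, size s)} :
  graded_mx t s D <->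
  forall i : 'I_(size t), graded_mx [:: nth 0%MM t i] s (row i D).
Proof.
split=> hD i; first by move=> i' j m; rewrite [i']ord1 mxE /=; apply: hD.
by move=> j m; have := hD i ord0 j m; rewrite mxE.
Qed.

Definition comp_mpoly (g a : mon) (f : R) : R :=
  if (a <= g)%MM then f@_(g - a) *: 'X_[g - a] else 0.

Lemma mcoeff_comp g a (f : R) m :
  (comp_mpoly g a f)@_m = f@_m *+ ((m + a)%MM == g).
Proof.
rewrite /comp_mpoly; case: ifP => [le_ag | nle_ag]; last first.
  rewrite mcoeff0; case: eqP => // e; move: nle_ag.
  by rewrite -e lem_addl.
rewrite mcoeffZ mcoeffX; have [<-|ne] := eqVneq (g - a)%MM m.
  by rewrite submK // eqxx mulr1.
by case: eqP => [e|]; rewrite mulr0 //; case/eqP: ne; rewrite -e addmK.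
Qed.

(** The homogeneous component of multidegree g.  Kernels of graded matrices are
    closed under it by [comp_rv_mul], which is how preimages of homogeneous
    vectors are made homogeneous. *)
Definition comp_rv g s (v : 'rV[R]_(size s)) : 'rV[R]_(size s) :=
  \row_j comp_mpoly g (nth 0%MM s j) (v 0 j).

Lemma comp_rv_graded g s v : graded_mx [:: g] s (comp_rv g s v).
Proof.
move=> i j m; rewrite [i]ord1 mxE mcoeff_msupp mcoeff_comp /=.
by have [//|_] := (m + nth 0 s j)%MM =P g; rewrite eqxx.
Qed.

Lemma comp_rv_id g s v : graded_mx [:: g] s v -> comp_rv g s v = v.
Proof.
move=> hv; apply/rowP => j; rewrite mxE; apply/mpolyP => m.
rewrite mcoeff_comp; have [//|ne] := eqVneq; apply/esym/eqP.
by rewrite -[_ == 0]negbK -mcoeff_msupp; apply: contra ne => /hv /eqP.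
Qed.

Lemma comp_rv0 g s : comp_rv g s 0 = 0.
Proof. by apply: comp_rv_id => i j m; rewrite mxE msupp0. Qed.

Lemma comp_rv_mul g t s (D : 'M[R]_(size t, size s)) v :
  graded_mx t s D -> comp_rv g s (v *m D) = comp_rv g t v *m D.
Proof.
move=> hD; apply/rowP => j; rewrite !mxE; apply/mpolyP => m.
rewrite mcoeff_comp !raddf_sum -sumrMnl; apply: eq_bigr => l _ /=.
(* The products contributing to the coefficient of m agree one by one: a term
   x.2 of the homogeneous entry D l j moves the degree by t_l - s_j. *)
rewrite !mcoeffM -sumrMnl; apply: eq_bigr => x /eqP def_m.
rewrite mxE mcoeff_comp mulrnAl.
have [->|nz] := eqVneq ((D l j)@_x.2) 0; first by rewrite mulr0 !mul0rn.
have <- : (x.1 + nth 0 t l = m + nth 0 s j)%MM; last by [].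
rewrite -(hD l j x.2) ?mcoeff_msupp // addmA.
exact: (congr1 (fun m' => m' + nth 0 s j)%MM (esym def_m)).
Qed.

(** * Resolutions of submodules of free modules *)

(** [resolves N s M degs]: the submodule M of the free module on s has a graded
    free resolution with at most N nonzero modules, the i-th one being free on
    degs i.  Peeling off one map at a time turns constructions of resolutions
    into inductions on N in which only one map has to be built. *)
Fixpoint resolves N (s : seq mon) (M : 'rV[R]_(size s) -> Prop)
    (degs : nat -> seq mon) : Prop :=
  if N is N'.+1 then
    exists D : 'M[R]_(size (degs 0), size s),
      [/\ graded_mx (degs 0) s D,
          forall v, M v <-> exists w, w *m D = v &
          resolves N' (degs 0) (fun w => w *m D = 0) (fun i => degs i.+1)]
  else (forall v, M v <-> v = 0) /\ forall i, degs i = [::].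

Lemma eq_resolves N s (M M' : 'rV[R]_(size s) -> Prop) degs degs' :
  (forall v, M v <-> M' v) -> degs =1 degs' ->
  resolves N s M degs -> resolves N s M' degs'.
Proof.
elim: N s M M' degs degs' => [|N IH] s M M' degs degs' eM ed /=.
  by case=> hM hd; split=> [v | i]; rewrite -?eM -?ed.
have e0 := ed 0%N; case: _ / e0 => -[D [hD hM res]].
exists D; split=> // [v|]; first by rewrite -eM.
by apply: IH res => // i; apply: ed.
Qed.

(** A resolution is padded by zero maps from free modules of rank 0. *)
Lemma resolvesS N s M degs : resolves N s M degs -> resolves N.+1 s M degs.
Proof.
elim: N s M degs => [|N IH] s M degs; last first.
  by case=> D [hD hM /IH res]; exists D.
case=> hM hd /=; exists 0; split=> [i j m | v | ].
- by rewrite mxE msupp0.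
- rewrite hM; split=> [-> | [w <-]]; last by rewrite mulmx0.
  by exists 0; rewrite mulmx0.
split=> // v; split=> [_|->]; last by rewrite mul0mx.
by apply/rowP => j; have := ltn_ord j; rewrite {2}hd.
Qed.

Lemma resolves_leq N N' s M degs :
  (N <= N')%N -> resolves N s M degs -> resolves N' s M degs.
Proof.
move=> /subnK <- res; elim: (N' - N)%N => // i IH.
by rewrite addSn; apply: resolvesS.
Qed.

(** The maps of a resolution, indexed by all natural numbers; D0 is the
    augmentation onto M. *)
Lemma resolves_maps {N s M degs} : resolves N s M degs ->
  exists (D0 : 'M[R]_(size (degs 0), size s))
         (D : forall i, 'M[R]_(size (degs i.+1), size (degs i))),
    [/\ graded_mx (degs 0) s D0, forall i, graded_mx _ _ (D i),
        forall v, M v <-> exists w, w *m D0 = v,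
        forall v : 'rV[R]_(size (degs 0)),
          v *m D0 = 0 <-> exists w, w *m D 0 = v &
        forall i (v : 'rV[R]_(size (degs i.+1))),
          v *m D i = 0 <-> exists w, w *m D i.+1 = v].
Proof.
elim: N s M degs => [|N IH] s M degs; last first.
  case=> D0 [gD0 hM /IH [D1 [D [gD1 gD ex1 ex2 ex]]]].
  exists D0, (fun i => if i is i'.+1 return 'M_(size (degs i.+1), size (degs i))
                       then D i' else D1).
  by split=> // [[|i] | [|i]].
case=> hM hd; exists 0, (fun i => 0).
have nil i (v w : 'rV[R]_(size (degs i))) : v = w.
  by apply/rowP => j; have := ltn_ord j; rewrite {2}hd.
split=> [i j m | i j l m | v | v | i v].
- by rewrite mxE msupp0.
- by rewrite mxE msupp0.
- rewrite hM; split=> [-> | [w <-]]; last by rewrite mulmx0.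
  by exists 0; rewrite mulmx0.
- by split=> _; [exists 0 | ]; [apply: nil | rewrite mulmx0].
- by split=> _; [exists 0 | ]; apply: nil.
Qed.

(** * The horseshoe lemma *)

(** Concatenating degree lists is the direct sum of free modules.  Stating this
    through injections and projections hides the casts along [size_cat]. *)
Lemma cat_biproduct (s t : seq mon) :
  exists (Is : 'M[R]_(size s, size (s ++ t)))
         (It : 'M[R]_(size t, size (s ++ t)))
         (Ps : 'M[R]_(size (s ++ t), size s))
         (Pt : 'M[R]_(size (s ++ t), size t)),
    [/\ [/\ graded_mx _ _ Ps, graded_mx _ _ Pt & graded_mx _ _ It],
        Is *m Ps = 1%:M /\ It *m Pt = 1%:M,
        Is *m Pt = 0 /\ It *m Ps = 0 & Ps *m Is + Pt *m It = 1%:M].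
Proof.
have gr (u v : seq mon) (D : 'M[R]_(size u, size v)) :
    (forall i j, exists2 b : bool, D i j = b%:R &
       b -> nth 0%MM v j = nth 0%MM u i) ->
    graded_mx u v D.
  move=> hD i j m; have [[] -> e] := hD i j; last by rewrite msupp0.
  by rewrite msupp1 inE e // => /eqP ->; rewrite add0m.
have nth_r (i : nat) : nth 0%MM (s ++ t) (size s + i) = nth 0%MM t i.
  by rewrite nth_cat ltnNge leq_addr addKn.
pose Is (p m : nat) : 'M[R]_(p, m) := \matrix_(i, j) (i == j :> nat)%:R.
pose It (p q m : nat) : 'M[R]_(q, m) := \matrix_(i, j) ((p + i)%N == j)%:R.
have IsE p q : Is p (p + q)%N = row_mx 1%:M 0.
  apply/matrixP => i j; rewrite !mxE; case: splitP => l ->; rewrite !mxE //.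
  by rewrite ltn_eqF // ltn_addr.
have ItE p q : It p q (p + q)%N = row_mx 0 1%:M.
  apply/matrixP => i j; rewrite !mxE; case: splitP => l ->; rewrite !mxE.
    by rewrite gtn_eqF // ltn_addr.
  by rewrite eqn_add2l.
exists (Is _ _), (It (size s) _ _), (Is _ _)^T, (It (size s) _ _)^T.
split; first split.
- apply: gr => i j; eexists; first by rewrite !mxE.
  by move/eqP <-; rewrite nth_cat ltn_ord.
- apply: gr => i j; eexists; first by rewrite !mxE.
  by move/eqP <-; rewrite nth_r.
- apply: gr => i j; eexists; first by rewrite !mxE.
  by move/eqP <-; rewrite nth_r.
all: rewrite (size_cat s t) IsE ItE !tr_row_mx !trmx0 !trmx1.
- by rewrite !mul_row_col !mulmx1 !mul0mx addr0 add0r.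
- by rewrite !mul_row_col !mulmx1 !mulmx0 !addr0.
- rewrite !mul_col_row !mulmx1 ?mul0mx ?mulmx0 add_block_mx.
  by rewrite !addr0 !add0r -scalar_mx_block.
Qed.

(** For an exact sequence 0 -> K -> M -> A -> 0, with M the kernel of B, the map
    to A induced by P and the map from K induced by E, the resolutions of K and
    A add up to one of M.  The first free module of A is lifted to M along P;
    together with that of K it covers M, and the kernels of the three covers
    form an exact sequence of the same kind, to which the induction applies.
    Taking M to be the kernel of a graded matrix makes it closed under
    homogeneous components, and this form is kept by the kernels. *)
Lemma horseshoe N (r s a0 k0 : seq mon)
    (B : 'M[R]_(size s, size r)) (P : 'M[R]_(size s, size a0))
    (E : 'M[R]_(size k0, size s))
    (A : 'rV[R]_(size a0) -> Prop) (K : 'rV[R]_(size k0) -> Prop) a b :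
  graded_mx s r B -> graded_mx s a0 P -> graded_mx k0 s E ->
  (forall v, A v <-> exists2 u : 'rV[R]_(size s), u *m B = 0 & u *m P = v) ->
  (forall u : 'rV[R]_(size s),
     u *m B = 0 /\ u *m P = 0 <-> exists2 w, K w & w *m E = u) ->
  (forall w : 'rV[R]_(size k0), w *m E = 0 -> w = 0) ->
  resolves N a0 A a -> resolves N k0 K b ->
  resolves N s (fun v => v *m B = 0) (fun i => a i ++ b i).
Proof.
elim: N r s a0 k0 B P E A K a b => [|N IH] r s a0 k0 B P E A K a b
  gB gP gE hA hK injE /=.
  move=> [A0 a_nil] [K0 b_nil]; split=> [v | i]; last by rewrite a_nil b_nil.
  split=> [vB | ->]; last by rewrite mul0mx.
  have /A0 vP: A (v *m P) by apply/hA; exists v.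
  have [w /K0 -> <-] : exists2 w, K w & w *m E = v by apply/hK.
  by rewrite mul0mx.
move=> [DA [gDA imA resA]] [DK [gDK imK resK]].
have [L [gL LB LP]] : exists L : 'M[R]_(size (a 0), size s),
    [/\ graded_mx (a 0) s L, L *m B = 0 & L *m P = DA].
  have lift (i : 'I_(size (a 0))) : exists u : 'rV[R]_(size s),
      [/\ graded_mx [:: nth 0%MM (a 0) i] s u, u *m B = 0 & u *m P = row i DA].
    have /hA [u uB uP]: A (row i DA).
      by apply/imA; exists (delta_mx 0 i); rewrite -rowE.
    (* The preimage u may be inhomogeneous; its component of the degree of the
       i-th generator has the same image. *)
    exists (comp_rv (nth 0%MM (a 0) i) s u); split.
    - exact: comp_rv_graded.
    - by rewrite -comp_rv_mul // uB comp_rv0.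
    - rewrite -comp_rv_mul // uP comp_rv_id //.
      by move/graded_rowP: gDA; apply.
  have [F hF] := fin_all_exists lift.
  exists (\matrix_i F i); split.
  - by apply/graded_rowP => i; rewrite rowK; case: (hF i).
  - by apply/row_matrixP => i; rewrite row_mul rowK row0; case: (hF i).
  - by apply/row_matrixP => i; rewrite row_mul rowK; case: (hF i).
have inK (w : 'rV[R]_(size (b 0))) :
    w *m DK *m E *m B = 0 /\ w *m DK *m E *m P = 0.
  by apply/hK; exists (w *m DK) => //; apply/imK; exists w.
have KB (w : 'rV[R]_(size (b 0))) : w *m DK *m E *m B = 0 by case: (inK w).
have KP (w : 'rV[R]_(size (b 0))) : w *m DK *m E *m P = 0 by case: (inK w).
have lift (v : 'rV[R]_(size s)) : v *m B = 0 -> forall x, x *m DA = v *m P ->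
    exists y, v = x *m L + y *m DK *m E.
  move=> vB x xv.
  have [w /imK [y <-] e] : exists2 w, K w & w *m E = v - x *m L.
    by apply/hK; rewrite !mulmxBl vB -!mulmxA LB LP xv mulmx0 !subrr.
  by exists y; rewrite e addrC subrK.
have [Ia [Ib [Pa [Pb [[gPa gPb gIb] [IPa IPb] [IaPb IbPa] PI]]]]] :=
  cat_biproduct (a 0) (b 0).
pose D := Pa *m L + Pb *m DK *m E.
have IaD : Ia *m D = L.
  by rewrite mulmxDr !mulmxA IPa mul1mx IaPb !mul0mx addr0.
have IbD : Ib *m D = DK *m E.
  by rewrite mulmxDr !mulmxA IPb mul1mx IbPa mul0mx add0r.
exists D; split.
- by apply: graded_addmx; do ?[apply: graded_mulmx; eauto].
- move=> v; split=> [vB | [w <-]]; last first.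
    by rewrite mulmxDr mulmxDl !mulmxA KB addr0 -!mulmxA LB !mulmx0.
  have /imA [x xv] : A (v *m P) by apply/hA; exists v.
  have [y ->] := lift v vB x xv.
  by exists (x *m Ia + y *m Ib); rewrite mulmxDl -!mulmxA IaD IbD.
(* The sequence of kernels: that of D maps onto that of DA by the projection Pa,
   and contains that of DK through the injection Ib. *)
apply: (IH _ _ _ _ D Pa Ib) resA resK => //; last first.
- by move=> w wIb; rewrite -[w]mulmx1 -IPb mulmxA wIb mul0mx.
- move=> u; split=> [[uD uPa] | [w wDK <-]].
    have eu : u *m Pb *m Ib = u.
      by rewrite -[RHS]mulmx1 -PI mulmxDr !mulmxA uPa mul0mx add0r.
    exists (u *m Pb) => //; apply: injE; rewrite -uD -[in RHS]eu.
    by rewrite -!mulmxA IbD.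
  by rewrite -!mulmxA IbD IbPa mulmx0 mulmxA wDK mul0mx.
- move=> v; split=> [vDA | [u uD <-]].
    have [|| y e] := lift 0 _ v; rewrite ?mul0mx //.
    exists (v *m Ia + y *m Ib).
      by rewrite mulmxDl -!mulmxA IaD IbD !mulmxA -e.
    by rewrite mulmxDl -!mulmxA IPa IbPa mulmx1 mulmx0 addr0.
  have e : u *m Pa *m L = - (u *m Pb *m DK *m E).
    by apply/eqP; rewrite -addr_eq0 -uD mulmxDr !mulmxA.
  by rewrite -LP mulmxA e mulNmx KP oppr0.
- by apply: graded_addmx; do ?[apply: graded_mulmx; eauto].
Qed.


(** * Monomial generators *)

Lemma sum_nth_delta (s : seq mon) (a : mon) (F : mon -> R) : uniq s ->
  \sum_(i < size s) (nth 0%MM s i == a)%:R * F (nth 0%MM s i) =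
  (a \in s)%:R * F a.
Proof.
move=> s_uniq; pose F' x := (x == a)%:R * F x.
rewrite -(big_mkord xpredT (fun i => F' (nth 0%MM s i))) -(big_nth _ xpredT F').
have [a_s|a_s] := boolP (a \in s).
  rewrite (bigD1_seq a) //= /F' eqxx big1 ?addr0 // => x /negbTE ->.
  by rewrite mul0r.
rewrite big1_seq ?mul0r // => x /= x_s; rewrite /F'.
by case: eqP x_s a_s => [-> -> //|_ _ _]; rewrite mul0r.
Qed.

(** Sends each basis vector of the free module on s to the basis vector of equal
    degree in the free module on t, and to 0 when there is none: an inclusion, a
    projection or a reordering, according to how s and t are related. *)
Definition sel_mx s t : 'M[R]_(size s, size t) :=
  \matrix_(i, j) (nth 0%MM s i == nth 0%MM t j)%:R.

(** The canonical map from the free module on s to the ideal generated by s. *)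
Definition gen_mx (s : seq mon) : 'M[R]_(size s, size [:: 0%MM : mon]) :=
  \matrix_(i, j) 'X_[nth 0%MM s i].

Lemma graded_sel s t : graded_mx s t (sel_mx s t).
Proof.
move=> i j m; rewrite mxE; case: eqP => [->|_]; last by rewrite msupp0.
by rewrite msupp1 inE => /eqP ->; rewrite add0m.
Qed.

Lemma graded_gen s : graded_mx s [:: 0%MM] (gen_mx s).
Proof.
by move=> i j m; rewrite [j]ord1 mxE msuppX inE => /eqP -> /=; rewrite addm0.
Qed.

Lemma sel_mul_sel s t u : uniq t -> {subset s <= t} ->
  sel_mx s t *m sel_mx t u = sel_mx s u.
Proof.
move=> t_uniq s_t; apply/matrixP => i j; rewrite !mxE.
have := sum_nth_delta t (nth 0%MM s i) (fun x => (x == nth 0%MM u j)%:R) t_uniq.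
rewrite s_t ?mem_nth // mul1r; apply: etrans.
by apply: eq_bigr => l _; rewrite !mxE eq_sym.
Qed.

Lemma sel_mul_gen s t : uniq t -> {subset s <= t} ->
  sel_mx s t *m gen_mx t = gen_mx s.
Proof.
move=> t_uniq s_t; apply/matrixP => i j; rewrite !mxE.
have := sum_nth_delta t (nth 0%MM s i) (fun x => 'X_[x]) t_uniq.
rewrite s_t ?mem_nth // mul1r; apply: etrans.
by apply: eq_bigr => l _; rewrite !mxE eq_sym.
Qed.

Lemma sel_id s : uniq s -> sel_mx s s = 1%:M.
Proof.
by move=> s_uniq; apply/matrixP => i j; rewrite !mxE nth_uniq // ltn_ord.
Qed.

Lemma sel_disjoint s t : (forall x, x \in s -> x \notin t) -> sel_mx s t = 0.
Proof.
move=> st; apply/matrixP => i j; rewrite !mxE; case: eqP => // e.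
have := st (nth 0%MM s i) (mem_nth _ (ltn_ord i)).
by rewrite e mem_nth.
Qed.

Lemma sel_split s t u : uniq s -> uniq t -> uniq u ->
  (forall x, x \in s = (x \in t) || (x \in u)) ->
  (forall x, x \in t -> x \notin u) ->
  sel_mx s t *m sel_mx t s + sel_mx s u *m sel_mx u s = 1%:M.
Proof.
move=> s_uniq t_uniq u_uniq stu tu; apply/matrixP => i j.
have mxsel v : uniq v -> (sel_mx s v *m sel_mx v s) i j =
    (nth 0%MM s i \in v)%:R * (nth 0%MM s i == nth 0%MM s j)%:R.
  move=> v_uniq; rewrite mxE.
  apply: etrans (sum_nth_delta v _ (fun x => (x == nth 0%MM s j)%:R) v_uniq).
  by apply: eq_bigr => l _; rewrite !mxE eq_sym.
rewrite mxE !mxsel // -mulrDl -natrD.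
have := stu (nth 0%MM s i); rewrite mem_nth // => /esym.
have := tu (nth 0%MM s i).
case: (_ \in t) => [/(_ isT)/negbTE -> _ | _ /= ->];
  by rewrite mul1r mxE nth_uniq.
Qed.

Lemma gen1_mx_inj p (u : 'rV[R]_(size [:: p])) :
  u *m gen_mx [:: p] = 0 -> u = 0.
Proof.
move/rowP => /(_ ord0); rewrite !mxE (bigD1 ord0) //= big1 => [|l]; last first.
  by rewrite [l]ord1.
rewrite addr0 !mxE /= => /eqP; rewrite mulf_eq0 -[X in _ || X]msupp_eq0 msuppX.
by rewrite orbF => /eqP u0; apply/rowP => j; rewrite [j]ord1 mxE.
Qed.

Lemma mon_ideal_seqP G (v : 'rV[R]_(size [:: 0%MM : mon])) :
  mon_ideal_seq G (v ord0 ord0) <-> exists w, w *m gen_mx G = v.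
Proof.
split=> [[s s_G e] | [w <-]]; last first.
  exists [seq (w 0 j, nth 0%MM G j) | j <- enum 'I_(size G)].
    by move=> q /mapP [j _ ->]; apply: mem_nth.
  by rewrite big_map big_enum /= mxE; apply: eq_bigr => j _; rewrite mxE.
have {e} -> : v = const_mx (\sum_(q <- s) q.1 * 'X_[q.2]).
  by apply/rowP => j; rewrite [j]ord1 e mxE.
elim: s s_G => [|q s IH] s_G.
  by exists 0; rewrite mul0mx big_nil; apply/rowP => j; rewrite !mxE.
have [q' q'_s | w e] := IH; first by apply: s_G; rewrite inE q'_s orbT.
have q_G : (index q.2 G < size G)%N by rewrite index_mem s_G // mem_head.
exists (q.1 *: delta_mx 0 (Ordinal q_G) + w).
rewrite mulmxDl e -scalemxAl -rowE big_cons; apply/rowP => j.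
by rewrite !mxE nth_index // s_G // mem_head.
Qed.

Lemma mon_ideal_seq_leq G m : mon_ideal_seq G ('X_[m] : R) ->
  exists2 g, g \in G & (g <= m)%MM.
Proof.
case=> s s_G e; have : m \in msupp ('X_[m] : R) by rewrite msuppX mem_head.
rewrite {}e => /msupp_sum_le /flattenP [_ /mapP [q q_s ->]].
rewrite (perm_mem (msuppMX _ _)) => /mapP [m' _ ->].
by exists q.2; [apply: s_G; move: q_s; rewrite filter_predT | apply: lem_addr].
Qed.

Lemma mon_ideal_seq_sub G G' :
  (forall g, g \in G -> exists2 g', g' \in G' & (g' <= g)%MM) ->
  forall f : R, mon_ideal_seq G f -> mon_ideal_seq G' f.
Proof.
move=> GG' f [s s_G ->]; elim: s s_G => [|q s IH] s_G.
  by exists [::]; rewrite ?big_nil.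
have [q' q'_s | s' s'_G' e] := IH; first by apply: s_G; rewrite inE q'_s orbT.
have [g g_G' le_g] := GG' _ (s_G q (mem_head _ _)).
exists ((q.1 * 'X_[q.2 - g], g) :: s'); last first.
  by rewrite !big_cons e /= -mulrA -mpolyXD submK.
by move=> x; rewrite inE => /predU1P [-> | /s'_G'].
Qed.

Lemma mon_ideal_seq_subset G G' : {subset G <= G'} ->
  forall f : R, mon_ideal_seq G f -> mon_ideal_seq G' f.
Proof.
move=> GG'; apply: mon_ideal_seq_sub => g /GG' g_G'; exists g => //.
exact: lepm_refl.
Qed.

Lemma mem_mon_ideal_seq G g : g \in G -> mon_ideal_seq G ('X_[g] : R).
Proof.
move=> g_G; exists [:: (1, g)]; last by rewrite big_seq1 mul1r.
by move=> q; rewrite inE => /eqP ->.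
Qed.

(** Any two minimal generating sets agree: g in G1 is divisible by some h in G2,
    itself divisible by some g' in G1; minimality forces g' = g, hence h = g. *)
Lemma min_mon_gens_sub (J : R -> Prop) G1 G2 :
  min_mon_gens J G1 -> min_mon_gens J G2 -> {subset G1 <= G2}.
Proof.
move=> [G1_uniq J1 min1] [_ J2 _] g g_G1.
have [h h_G2 le_hg] : exists2 h, h \in G2 & (h <= g)%MM.
  by apply: mon_ideal_seq_leq; apply/J2/J1; apply: mem_mon_ideal_seq.
have [g' g'_G1 le_g'h] : exists2 g', g' \in G1 & (g' <= h)%MM.
  by apply: mon_ideal_seq_leq; apply/J1/J2; apply: mem_mon_ideal_seq.
have [e | ne] := eqVneq g' g.
  suff -> : g = h by [].
  apply/mnmP => i; apply/eqP; rewrite eqn_leq.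
  by rewrite -{1}e (mnm_lepP le_g'h) (mnm_lepP le_hg).
have /min1 : {subset rem g G1 <= G1} by apply: mem_rem.
have G1_rem f : J f <-> mon_ideal_seq (rem g G1) f.
  rewrite J1; split; last by apply: mon_ideal_seq_subset; apply: mem_rem.
  apply: mon_ideal_seq_sub => x x_G1; have [->|nx] := eqVneq x g.
    by exists g'; [rewrite mem_rem_uniq // !inE ne | apply: lepm_trans le_hg].
  by exists x; [rewrite mem_rem_uniq // !inE nx | apply: lepm_refl].
by move=> /(_ G1_rem g g_G1); rewrite mem_rem_uniqF.
Qed.

(** Adding p back to a smaller generating set of <G minus p> would give a
    smaller generating set of J. *)
Lemma min_mon_gens_rem (J : R -> Prop) G p : min_mon_gens J G -> p \in G ->
  min_mon_gens (mon_ideal_seq (rem p G) : R -> Prop) (rem p G).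
Proof.
move=> [G_uniq JG minG] p_G; split=> // [|G' G'_rem eG'].
  exact: rem_uniq.
have /minG sub : {subset p :: G' <= G}.
  by move=> x; rewrite inE => /predU1P [-> // | /G'_rem /mem_rem].
move=> x x_rem; suff: x \in p :: G'.
  rewrite inE => /predU1P [xp|//]; move: x_rem.
  by rewrite xp mem_rem_uniqF.
apply: sub (mem_rem x_rem) => f; rewrite JG; split; last first.
  apply: mon_ideal_seq_subset => y; rewrite inE.
  by move=> /predU1P [-> // | /G'_rem /mem_rem].
apply: mon_ideal_seq_sub => g g_G; have [-> | ne] := eqVneq g p.
  by exists p; [apply: mem_head | apply: lepm_refl].
have [|h h_G' le_hg] := @mon_ideal_seq_leq G' g.
  by apply/eG'/mem_mon_ideal_seq; rewrite mem_rem_uniq // !inE ne.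
by exists h; rewrite // inE h_G' orbT.
Qed.

(** * Mayer-Vietoris trees *)

Definition mvt_gens {J : R -> Prop} (T : mvt J) : seq mon :=
  match T with MVLeaf m _ => [:: m] | MVNode G _ _ _ _ _ _ => G end.

Lemma mvt_gensP {J : R -> Prop} (T : mvt J) : min_mon_gens J (mvt_gens T).
Proof. by case: T. Qed.

(** The basis degrees of the iterated resolution, defined by the recursion
    coming from the exact sequences of the nodes. *)
Fixpoint cone_degs {J : R -> Prop} (T : mvt J) (i : nat) : seq mon :=
  match T, i with
  | _, 0 => mvt_gens T
  | MVLeaf _ _, _.+1 => [::]
  | MVNode _ _ _ _ _ Tl Tr, i'.+1 => cone_degs Tl i' ++ cone_degs Tr i
  end.

Lemma cone_degs0 {J : R -> Prop} (T : mvt J) : cone_degs T 0 = mvt_gens T.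
Proof. by case: T. Qed.

(** The node step.  The free module on G splits as the one on the pivot plus the
    one on G'; through this splitting the relations on G project onto the
    intersection of the two ideals, with the relations on G' as kernel. *)
Lemma pivot_ker_resolves (J : R -> Prop) G p G' N a b :
  min_mon_gens J G -> p \in G ->
  min_mon_gens (mon_ideal_seq (rem p G) : R -> Prop) G' ->
  resolves N [:: 0%MM]
    (fun v => ideal_cap (mon_ideal_seq (rem p G)) (mon_ideal_seq [:: p])
                        (v ord0 ord0)) a ->
  resolves N G' (fun v => v *m gen_mx G' = 0) b ->
  resolves N G (fun v => v *m gen_mx G = 0) (fun i => a i ++ b i).
Proof.
move=> hG p_G hG' resA resK.
have [G_uniq _ _] := hG; have [G'_uniq eG' _] := hG'.
have mem_G' : G' =i rem p G.
  have hrem := min_mon_gens_rem _ _ _ hG p_G.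
  by move=> x; apply/idP/idP;
    apply: (min_mon_gens_sub (mon_ideal_seq (rem p G))).
have p_G' x : x \in [:: p] -> x \notin G'.
  by rewrite inE => /eqP ->; rewrite mem_G' mem_rem_uniqF.
have sG'G : {subset G' <= G} by move=> x; rewrite mem_G' => /mem_rem.
have spG : {subset [:: p] <= G} by move=> x; rewrite inE => /eqP ->.
have split1 : sel_mx G [:: p] *m sel_mx [:: p] G +
    sel_mx G G' *m sel_mx G' G = 1%:M.
  apply: sel_split => // x; rewrite inE mem_G' mem_rem_uniq // !inE.
  by case: eqP => [->|].
have inj_E : sel_mx G' G *m sel_mx G G' = 1%:M.
  by rewrite sel_mul_sel // sel_id.
pose P := sel_mx G [:: p] *m gen_mx [:: p].
have EP : sel_mx G' G *m P = 0.
  rewrite mulmxA sel_mul_sel // sel_disjoint ?mul0mx // => x xG'.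
  by apply: contraL xG' => /p_G'.
have EB : sel_mx G' G *m gen_mx G = gen_mx G' by apply: sel_mul_gen.
have pB : sel_mx [:: p] G *m gen_mx G = gen_mx [:: p] by apply: sel_mul_gen.
have pP : sel_mx [:: p] G *m P = gen_mx [:: p].
  by rewrite mulmxA sel_mul_sel // sel_id // mul1mx.
have BE : gen_mx G = P + sel_mx G G' *m gen_mx G'.
  by rewrite -[LHS]mul1mx -split1 mulmxDl -!mulmxA EB pB.
apply: (horseshoe _ _ _ _ _ (gen_mx G) P (sel_mx G' G)) resA resK.
- exact: graded_gen.
- exact: graded_mulmx (graded_sel _ _) (graded_gen _).
- exact: graded_sel.
- move=> v; split=> [[/eG' /mon_ideal_seqP [w wv] /mon_ideal_seqP [x xv]]|].
    (* v = x_p x^p = w . G' gives the relation with pivot entry x_p and with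
       -w on the other generators. *)
    exists (x *m sel_mx [:: p] G - w *m sel_mx G' G).
      by rewrite mulmxBl -!mulmxA EB pB xv wv subrr.
    by rewrite mulmxBl -!mulmxA EP pP mulmx0 subr0.
  case=> u uB <-; split; last first.
    by apply/mon_ideal_seqP; exists (u *m sel_mx G [:: p]); rewrite mulmxA.
  apply/eG'/mon_ideal_seqP; exists (- (u *m sel_mx G G')).
  by apply/eqP; rewrite mulNmx eq_sym -addr_eq0 -mulmxA -mulmxDr -BE uB.
- move=> u; split=> [[uB uP] | [w wG' <-]]; last first.
    by rewrite -!mulmxA EB EP mulmx0.
  have up0 : u *m sel_mx G [:: p] = 0 by apply: gen1_mx_inj; rewrite -mulmxA.
  have uQE : u *m sel_mx G G' *m sel_mx G' G = u.
    by rewrite -[RHS]mulmx1 -split1 mulmxDr !mulmxA up0 mul0mx add0r.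
  by exists (u *m sel_mx G G'); rewrite // -EB mulmxA uQE.
- by move=> w wE; rewrite -[w]mulmx1 -inj_E mulmxA wE mul0mx.
Qed.

Lemma resolves_ideal (J : R -> Prop) (T : mvt J) N :
  resolves N (mvt_gens T) (fun v => v *m gen_mx (mvt_gens T) = 0)
    (fun i => cone_degs T i.+1) ->
  resolves N.+1 [:: 0%MM] (fun v => J (v ord0 ord0)) (cone_degs T).
Proof.
move=> res; have [_ eJ _] := mvt_gensP T.
rewrite /= cone_degs0; exists (gen_mx (mvt_gens T)); split=> //.
- exact: graded_gen.
- by move=> v; rewrite eJ; apply: mon_ideal_seqP.
Qed.

(** Induction on the tree for the relations on the generators of the root, which
    are resolved by the terms of positive degree. *)
Lemma gens_ker_resolves (J : R -> Prop) (T : mvt J) :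
  exists N, resolves N (mvt_gens T) (fun v => v *m gen_mx (mvt_gens T) = 0)
    (fun i => cone_degs T i.+1).
Proof.
elim: J / T => [J m hm | J G p hG G_gt1 p_G Tl [Nl resl] Tr [Nr resr]].
  exists 0%N; split=> // v; split=> [|->]; last by rewrite mul0mx.
  exact: gen1_mx_inj.
exists (maxn Nl.+1 Nr).
apply: (pivot_ker_resolves _ _ _ (mvt_gens Tr) _ _ _ hG p_G (mvt_gensP Tr)).
  by apply: resolves_leq (leq_maxl _ _) _; apply: resolves_ideal.
exact: resolves_leq (leq_maxr _ _) resr.
Qed.

Definition relevant_degs (pos dim i : nat) {J : R -> Prop} (T : mvt J) :
    seq mon :=
  flatten [seq node_gens v | v <- mvt_nodes_from pos dim T
                           & relevant v && (node_dim v == i)].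

Lemma relevant_degs_lt pos dim i (J : R -> Prop) (T : mvt J) :
  (i < dim)%N -> relevant_degs pos dim i T = [::].
Proof.
rewrite /relevant_degs.
elim: J / T pos dim => [J m hm | J G p hG G_gt1 p_G Tl IHl Tr IHr] pos dim lt_i.
  by rewrite /= gtn_eqF // andbF.
by rewrite /= gtn_eqF // andbF filter_cat map_cat flatten_cat IHl ?IHr // ltnW.
Qed.

(** Relevance of the nodes below the root of a subtree does not depend on the
    position of that root, so the relevant nodes give [cone_degs], up to the
    generators of the root when it is itself irrelevant. *)
Lemma relevant_degsE pos dim i (J : R -> Prop) (T : mvt J) : (0 < pos)%N ->
  relevant_degs pos dim (dim + i) T =
  if (i == 0)%N && (pos != 1)%N && odd pos then [::] else cone_degs T i.
Proof.
have lt_dim d j : (d < d + j.+1)%N by rewrite -addSnnS leq_addr.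
elim: J / T pos dim i => [J m hm | J G p hG G_gt1 p_G Tl IHl Tr IHr]
  pos dim i pos_gt0.
  rewrite /relevant_degs /= /relevant /=.
  case: i => [|i]; first by rewrite addn0 eqxx andbT; case: eqP; case: odd.
  by rewrite (ltn_eqF (lt_dim dim i)) andbF.
pose degs_r := relevant_degs (2 * pos).+1 dim (dim + i) Tr.
pose degs_l := relevant_degs (2 * pos) dim.+1 (dim + i) Tl.
have -> : relevant_degs pos dim (dim + i)
      (@MVNode _ _ J G p hG G_gt1 p_G Tl Tr) =
    (if ((pos == 1) || ~~ odd pos) && (dim == dim + i) then G else [::])%N
    ++ degs_l ++ degs_r.
  by rewrite {1}/relevant_degs /= {1}/relevant /=; case: ifP => _;
    rewrite /= filter_cat map_cat flatten_cat.
have pos2 : (0 < 2 * pos)%N by rewrite muln_gt0.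
rewrite {}/degs_l {}/degs_r IHr //; case: i => [|i].
  rewrite relevant_degs_lt ?addn0 // eqxx andbT /= mul2n odd_double /=.
  rewrite eqSS double_eq0 -lt0n pos_gt0 /= cats0.
  by case: eqP; case: odd.
rewrite (ltn_eqF (lt_dim dim i)) andbF -addSnnS IHl //=.
by rewrite mul2n odd_double andbF.
Qed.

Lemma mvt_degreesE (J : R -> Prop) (T : mvt J) i :
  mvt_degrees T i = cone_degs T i.
Proof.
by apply: etrans (relevant_degsE 1 0 i _ T isT) _; rewrite andbF.
Qed.

End GradedMaps.

Theorem theorem3p1p10 (k : fieldType) (n : nat) (hk : [pchar k] =i pred0)
    (I : {mpoly k[n]} -> Prop) (hI : nz_monomial_ideal I) (T : mvt I) :
  exists (eps : {linear 'rV[{mpoly k[n]}]_(size (mvt_degrees T 0)) ->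
                        {mpoly k[n]}^o})
         (d : forall i : nat,
            {linear 'rV[{mpoly k[n]}]_(size (mvt_degrees T i.+1)) ->
                    'rV[{mpoly k[n]}]_(size (mvt_degrees T i))}),
    mg_free_resolution I (degs := mvt_degrees T) eps d.
Proof.
have [N res] := gens_ker_resolves _ T.
have {}res : resolves N.+1 [:: 0%MM] (fun v => I (v ord0 ord0)) (mvt_degrees T).
  apply: (eq_resolves _ _ _ _ _ _ _ _ (resolves_ideal _ _ _ res)) => // i.
  by rewrite mvt_degreesE.
have [D0 [D [gD0 gD im0 ex0 ex]]] := resolves_maps res.
(* The augmentation takes values in row vectors of length 1; its only entry is
   the required map to R. *)
pose eps0 (v : 'rV[{mpoly k[n]}]_(size (mvt_degrees T 0))) : {mpoly k[n]}^o :=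
  (v *m D0) ord0 ord0.
have eps_lin : linear eps0.
  by move=> c u v; rewrite /eps0 mulmxDl -scalemxAl !mxE.
pose eps_mixin := GRing.isLinear.Build _ _ _ _ eps0 eps_lin.
pose eps : {linear 'rV[{mpoly k[n]}]_(size (mvt_degrees T 0)) ->
                        {mpoly k[n]}^o} := HB.pack eps0 eps_mixin.
have eps_mx v : v *m D0 = const_mx (eps v).
  by apply/rowP => j; rewrite [j]ord1 [RHS]mxE.
exists eps, (fun i => mulmxr (D i)); split.
- move=> g v gv m m_eps.
  have gv' : graded_mx [:: g] (mvt_degrees T 0) v.
    by move=> i j m'; rewrite [i]ord1; apply: gv.
  by have := graded_mulmx gv' gD0 ord0 ord0 m m_eps; rewrite /= addm0.
- move=> i g v gv j m.
  have gv' : graded_mx [:: g] (mvt_degrees T i.+1) v.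
    by move=> i' j' m'; rewrite [i']ord1; apply: gv.
  exact: (graded_mulmx gv' (gD i) ord0 j m).
- move=> f; have := im0 (const_mx f); rewrite mxE => ->.
  split=> [[v e] | [v <-]]; exists v; first by rewrite /= /eps0 e mxE.
  exact: eps_mx.
- move=> v; rewrite -ex0 eps_mx; split=> [-> | /rowP /(_ ord0)].
    by apply/rowP => j; rewrite !mxE.
  by rewrite !mxE.
- by move=> i v; rewrite /= ex.
Qed.
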